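(* For every integer $n\ge 100$, $\mathrm{wsat}_4(n,B_4)\geq \frac{6}{13}n-\frac{11}{13}$. Moreover, this bound is sharp for $n\equiv 4 \pmod{13}$: for every $n\ge 100$ with $n\equiv 4\pmod{13}$, $\mathrm{wsat}_4(n,B_4)=\frac{6n-11}{13}$.
   Context: A $4$-uniform hypergraph $H$ has a vertex set $V(H)$ and a set $E(H)$ of $4$-element subsets of $V(H)$ (hyperedges). The bow tie $B_4$ is the $4$-uniform hypergraph with $7$ vertices and two hyperedges sharing exactly one vertex; a $4$-uniform hypergraph contains a copy of $B_4$ iff two of its hyperedges intersect in exactly one vertex. A $4$-uniform hypergraph $H$ on $n$ vertices is $B_4$-semi-saturated if for every $4$-subset $e\subseteq V(H)$ with $e\notin E(H)$ there is a hyperedge $f\in E(H)$ with $|e\cap f|=1$ (so adding $e$ creates a new copy of $B_4$); $H$ itself need not be $B_4$-free. $\mathrm{wsat}_4(n,B_4)$ denotes the minimum number of hyperedges of an $n$-vertex $4$-uniform $B_4$-semi-saturated hypergraph. *)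

(* Defs.v *)
From mathcomp Require Import all_boot.
Set Implicit Arguments. Unset Strict Implicit. Unset Printing Implicit Defensive.

Definition uniform4 (n : nat) (E : {set {set 'I_n}}) : Prop :=
  forall f, f \in E -> #|f| = 4.

Definition B4_semisat (n : nat) (E : {set {set 'I_n}}) : Prop :=
  forall e : {set 'I_n}, #|e| = 4 -> e \notin E ->
    exists2 f, f \in E & #|e :&: f| = 1.

(* Main.v *)
Require Import Defs.
From mathcomp Require Import all_boot.
From mathcomp Require Import zify.
Set Implicit Arguments. Unset Strict Implicit. Unset Printing Implicit Defensive.

(** Lower bound.  Let d(x) be the degree of x, call a vertex of degree 1 a leaf
    and two vertices in the same hyperedges twins.  A 4-set meeting no hyperedge
    in exactly one vertex is a hyperedge.  Applied to the union of two twin pairs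
    this confines the harmful twins to a set F that is empty or a hyperedge.
    Applied to {l, x, x', l'}, with leaves l in f, l' in f' and degree-2
    vertices x in f and g, x' in f' and g, it shows that, away from F, each
    hyperedge g receives at most one pair (l, x) from elsewhere.  The leaves
    therefore satisfy 3 #leaves <= 3 #F + #E + (degree sum over d >= 3), and
    double counting of the incidences concludes.  Isolated vertices are
    compensated by the leaf edges, which then receive nothing.

    Sharpness.  Read a hypergraph with degrees at most 2 as a graph: hyperedges
    become nodes, vertices of degree 2 become edges, leaves become half-edges.
    The 6k nodes (i, 0), ..., (i, 5), i in Z/k, form k gadgets: the adjacent
    nodes (i, 0) and (i, 1) carry half-edges, (i, 0) is joined to (i, 2) and
    (i, 3), (i, 1) to (i, 4) and (i, 5), and six cyclic edge families make the
    last four nodes 4-valent.  For k >= 4 these graphs have no set of 1, 2 or 4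
    edges and half-edges without a node of degree 1.  This is computed for
    4 <= k <= 7, disjoint unions give all k, and a disjoint single hyperedge
    completes the example. *)

(** * Lower bound *)

Lemma card_le_in (T U : finType) (h : T -> U) (A : {set T}) (B : {set U}) :
  {in A &, injective h} -> {in A, forall x, h x \in B} -> #|A| <= #|B|.
Proof.
move=> inj sub; rewrite -(card_in_imset inj); apply: subset_leq_card.
by apply/subsetP => _ /imsetP [x /sub ? ->].
Qed.

Lemma card_dep_pairs (T U : finType) (A : {set T}) (B : T -> {set U}) :
  #|[set p : T * U | (p.1 \in A) && (p.2 \in B p.1)]| = \sum_(x in A) #|B x|.
Proof.
rewrite -sum1dep_card -(pair_big_dep (mem A) (fun x y => y \in B x) (fun _ _ => 1)) /=.
by apply: eq_bigr => x _; rewrite sum1_card.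
Qed.

Section LowerBound.

Context (n : nat) (E : {set {set 'I_n}}).
Context (unif : uniform4 E) (sat : B4_semisat E).

(** * Leaves, twins and the exceptional set *)

Definition inc (x : 'I_n) : {set {set 'I_n}} := [set f in E | x \in f].
Definition leaves : {set 'I_n} := [set x | #|inc x| == 1].
Definition isolated : {set 'I_n} := [set x | #|inc x| == 0].
Definition edge_of (x : 'I_n) : {set 'I_n} := odflt set0 [pick f in inc x].
Definition other_edge (f : {set 'I_n}) (x : 'I_n) : {set 'I_n} :=
  odflt set0 [pick g in inc x :\ f].

Lemma mem_inc (x : 'I_n) (f : {set 'I_n}) : (f \in inc x) = (f \in E) && (x \in f).
Proof. by rewrite inE. Qed.

Lemma free4_edge (a b c d : 'I_n) : uniq [:: a; b; c; d] ->
  (forall f, f \in E -> (a \in f) + (b \in f) + (c \in f) + (d \in f) != 1) ->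
  exists2 h, h \in E & h =i [:: a; b; c; d].
Proof.
move=> u fr; pose e := [set x in [:: a; b; c; d]].
have e4 : #|e| = 4 by rewrite cardsE (card_uniqP u).
exists e; last by move=> x; rewrite inE.
apply/negPn/negP => /(sat e4) [f /fr nf ef]; case/eqP: nf; rewrite -[RHS]ef.
rewrite -sum1_card (eq_bigl (fun x => (x \in [:: a; b; c; d]) && (x \in f))); last first.
  by move=> x; rewrite !inE.
rewrite big_mkcondr -big_uniq // !big_cons big_nil.
by case: (a \in f); case: (b \in f); case: (c \in f); case: (d \in f).
Qed.

Lemma inc_leaf (l : 'I_n) : l \in leaves -> inc l = [set edge_of l].
Proof.
rewrite inE => /cards1P [f E1]; rewrite E1 /edge_of; case: pickP => [g|/(_ f)].
  by rewrite E1 inE => /eqP ->.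
by rewrite E1 set11.
Qed.

Lemma mem_leaf (l : 'I_n) (f : {set 'I_n}) :
  l \in leaves -> f \in E -> (l \in f) = (f == edge_of l).
Proof.
by move=> /inc_leaf El fE; have := mem_inc l f; rewrite El fE inE => ->.
Qed.

Lemma edge_of_leaf (l : 'I_n) : l \in leaves -> edge_of l \in E /\ l \in edge_of l.
Proof.
by move=> /inc_leaf El; have := mem_inc l (edge_of l); rewrite El set11 => /esym/andP.
Qed.

Lemma inc_deg2 (x : 'I_n) (f : {set 'I_n}) : #|inc x| = 2 -> f \in inc x ->
  inc x = [set f; other_edge f x] /\ other_edge f x != f.
Proof.
move=> d2 fx; have /cards1P [g Eg] : #|inc x :\ f| == 1.
  by have := cardsD1 f (inc x); rewrite fx d2 => -[]; rewrite add0n => <-.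
have -> : other_edge f x = g.
  rewrite /other_edge; case: pickP => [h|/(_ g)]; rewrite Eg inE ?eqxx //.
  by move/eqP.
have : g \in inc x :\ f by rewrite Eg set11.
by rewrite !inE => /andP [gf _]; rewrite -[inc x](setD1K fx) Eg.
Qed.

Lemma mem_deg2 (x : 'I_n) (f g : {set 'I_n}) : #|inc x| = 2 -> f \in inc x ->
  g \in E -> (x \in g) = (g == f) || (g == other_edge f x).
Proof.
move=> d2 fx gE; have [Ex _] := inc_deg2 d2 fx.
by have := mem_inc x g; rewrite gE /= Ex !inE.
Qed.

(** Every hyperedge meets two twin pairs in an even number of vertices. *)
Lemma twin_pairs_edge (x x' y y' : 'I_n) : uniq [:: x; x'; y; y'] ->
  inc x = inc x' -> inc y = inc y' ->
  exists2 h, h \in E & h =i [:: x; x'; y; y'].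
Proof.
move=> u Ex Ey; apply: free4_edge => // f fE.
have := mem_inc x f; rewrite Ex mem_inc fE /= => ->.
have := mem_inc y f; rewrite Ey mem_inc fE /= => ->.
by case: (x \in f); case: (y \in f).
Qed.

(** [F] contains all twins that could spoil the injectivity of [other_edge_inj]. *)
Definition covers (F : {set 'I_n}) : Prop :=
  {in leaves &, forall l l', l != l' -> edge_of l = edge_of l' -> l \in F} /\
  (forall x x' l, #|inc x| = 2 -> x != x' -> inc x = inc x' ->
     l \in leaves -> x \in edge_of l -> x \in F).

(** If two leaves share a hyperedge, that one is [F]; failing that, degree-2 twins in a leaf edge
    make their other hyperedge [F]. The recorded twins later bound the number of isolated
    vertices. *)
Lemma covers_ex : exists2 F, covers F &
  F = set0 \/ F \in E /\ exists x x', [/\ x != x', inc x = inc x' & inc x != set0].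
Proof.
have leaf2 l x : l \in leaves -> #|inc x| = 2 -> l != x.
  by move=> ll d2; apply: contraTneq ll => ->; rewrite inE d2.
case: (boolP [exists l in leaves, [exists l' in leaves, (l != l') && (edge_of l == edge_of l')]]).
  case/exists_inP => l ll /exists_inP [l' ll' /andP [neq /eqP eql]].
  have [fE lf] := edge_of_leaf ll.
  have il : inc l = inc l' by rewrite !inc_leaf ?eql.
  exists (edge_of l); last first.
    right; split=> //; exists l, l'; split=> //.
    by apply/set0Pn; exists (edge_of l); rewrite mem_inc fE.
  (* Twins disjoint from [l], [l'] form a hyperedge with them; it contains the leaf [l], so it is
     [edge_of l]. *)
  have twin x x' : x != x' -> inc x = inc x' -> inc x != set0 -> x \in edge_of l.
    move=> xx' ix x0.
    have near y : (y == l) || (y == l') -> y \in edge_of l.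
      by case/orP => /eqP -> //; rewrite eql; case: (edge_of_leaf ll').
    case: (boolP ((x == l) || (x == l'))) => [/near //|/norP [xl xl']].
    case: (boolP ((x' == l) || (x' == l'))) => [/near x'f|/norP [x'l x'l']].
      have : edge_of l \in inc x' by rewrite mem_inc fE.
      by rewrite -ix mem_inc => /andP [].
    have [||//|h hE hs] := @twin_pairs_edge l l' x x'.
      by rewrite /= !inE !negb_or neq xx' ![l == _]eq_sym ![l' == _]eq_sym xl xl' x'l x'l'.
    by [].
    have : l \in h by rewrite hs mem_head.
    by rewrite (mem_leaf ll hE) => /eqP <-; rewrite hs !inE eqxx !orbT.
  split=> [x x' lx lx' xx' ee|x x' l0 d2 xx' ix _ _].
    apply: (twin _ x') => //; first by rewrite !inc_leaf ?ee.
    by rewrite inc_leaf //; apply/set0Pn; exists (edge_of x); rewrite set11.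
  by apply: (twin _ x') => //; rewrite -card_gt0 d2.
move=> noleaf.
have H1 F : {in leaves &, forall l l', l != l' -> edge_of l = edge_of l' -> l \in F}.
  move=> l l' ll ll' neq eql; case/negP: noleaf; apply/exists_inP; exists l => //.
  by apply/exists_inP; exists l'; rewrite // neq eql /=.
case: (boolP [exists x, [exists x', [exists l in leaves,
    [&& #|inc x| == 2, x != x', inc x == inc x' & x \in edge_of l]]]]); last first.
  move=> no; exists set0; last by left.
  split=> // x x' l d2 xx' ix ll xl; case/negP: no.
  apply/existsP; exists x; apply/existsP; exists x'; apply/exists_inP; exists l => //.
  by rewrite d2 xx' ix xl !eqxx.
case/existsP => x /existsP [x' /exists_inP [l ll /and4P [/eqP d2 xx' /eqP ix xl]]].
have [fE lf] := edge_of_leaf ll.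
have fx : edge_of l \in inc x by rewrite mem_inc fE.
have [incx ne] := inc_deg2 d2 fx.
set g := other_edge _ _ in incx ne.
have gx : g \in inc x by rewrite incx !inE eqxx orbT.
have gE : g \in E by move: gx; rewrite mem_inc => /andP [].
exists g; last first.
  by right; split=> //; exists x, x'; split=> //; rewrite -card_gt0 d2.
split=> // y y' l' dy yy' iy _ _.
have near z : inc z = inc x -> z \in g.
  by move=> iz; move: gx; rewrite -iz mem_inc => /andP [].
case: (eqVneq y x) => [->|yx]; first exact: near.
case: (eqVneq y x') => [->|yx']; first by apply: near.
case: (eqVneq y' x) => [e|y'x]; first by apply: near; rewrite iy e.
case: (eqVneq y' x') => [e|y'x']; first by apply: near; rewrite iy e ix.
have [|//|//|h hE hs] := @twin_pairs_edge x x' y y'.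
  by rewrite /= !inE !negb_or xx' yy' ![x == _]eq_sym ![x' == _]eq_sym yx yx' y'x y'x'.
(* [h] is [edge_of l] or [g]; the former contains the leaf [l], while all four vertices of [h] have
   degree 2. *)
have : x \in h by rewrite hs mem_head.
rewrite (mem_deg2 d2 fx hE) => /orP [/eqP hl|/eqP hg]; last by rewrite /g -hg hs !inE eqxx !orbT.
have : l \in h by rewrite hl.
rewrite hs !inE !(negPf (leaf2 _ _ ll _)) //; first by rewrite -iy.
by rewrite -ix.
Qed.

(** * Counting incidences and leaves *)

Lemma sum_degree : \sum_x #|inc x| = 4 * #|E|.
Proof.
transitivity (\sum_(x : 'I_n) \sum_(f in E) (x \in f : nat)).
  apply: eq_bigr => x _; rewrite -sum1dep_card big_mkcondr.
  by apply: eq_bigr => f _; case: (x \in f).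
rewrite exchange_big /= mulnC -sum_nat_const; apply: eq_bigr => f /unif <-.
by rewrite -sum1_card [RHS]big_mkcond; apply: eq_bigr => x _; case: (x \in f).
Qed.

(** Sum over the vertices of 6 + d[d > 2] <= 3d + 6[d = 0] + 3[d = 1], which is tight for d <= 3. *)
Lemma degree_count :
  6 * n + \sum_(x | 2 < #|inc x|) #|inc x| <= 12 * #|E| + 6 * #|isolated| + 3 * #|leaves|.
Proof.
rewrite -[12]/(3 * 4) -mulnA -sum_degree -[n in 6 * n]card_ord -[#|isolated|]sum1_card.
rewrite -[#|leaves|]sum1_card -[#|'I_n|]sum1_card !big_distrr /=.
rewrite (big_mkcond (fun x => 2 < _)) (big_mkcond (mem isolated)) (big_mkcond (mem leaves)) /=.
rewrite -!big_split; apply: leq_sum => x _; rewrite !inE /=.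
by case: #|inc x| => [|[|[|d]]] //=; lia.
Qed.

(** The only possible values of [other_edge (edge_of l) x] for a leaf [l] and a
    degree-2 vertex [x] of [edge_of l] outside [F]. *)
Definition receivers (F : {set 'I_n}) : {set {set 'I_n}} :=
  [set g in E | (g != F) && ((isolated == set0) || [disjoint leaves & g])].

(** If this hyperedge held a leaf [l'] and some [i] were isolated, then {l, x, l', i} would meet the
    edges of [l] and [l'] twice and no others, so it would be a hyperedge through [i]. *)
Lemma other_edge_receiver (F : {set 'I_n}) (l x : 'I_n) :
  l \in leaves -> x \in edge_of l -> x \notin F -> #|inc x| = 2 ->
  other_edge (edge_of l) x \in receivers F.
Proof.
move=> ll xl xF d2; have [fE lf] := edge_of_leaf ll.
have fx : edge_of l \in inc x by rewrite mem_inc fE.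
have [incx ne] := inc_deg2 d2 fx.
set g := other_edge _ _ in incx ne *.
have : g \in inc x by rewrite incx !inE eqxx orbT.
rewrite mem_inc => /andP [gE xg]; rewrite inE gE /=; apply/andP; split.
  by apply: contraNneq xF => <-.
case: (set_0Vmem isolated) => [-> |[i ii]]; first by rewrite eqxx.
apply/orP; right; rewrite disjoints_subset; apply/subsetP => l' ll'; rewrite inE.
apply/negP => l'g.
have gl' : g = edge_of l' by apply/eqP; rewrite -mem_leaf.
have iE h : h \in E -> i \in h = false.
  move=> hE; move: ii; rewrite inE cards_eq0 => /eqP i0.
  by have := mem_inc i h; rewrite i0 hE in_set0.
have [||h hE hs] := @free4_edge l x l' i.
- have lx : l != x by apply: contraTneq ll => ->; rewrite inE d2.
  have xl' : x != l' by apply: contraTneq ll' => <-; rewrite inE d2.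
  have ll'n : l != l' by apply: contraNneq ne => e; rewrite gl' e.
  have ni y : y \in edge_of l \/ y \in g -> y != i.
    by case=> yh; apply: contraTneq yh => ->; rewrite iE.
  by rewrite /= !inE !negb_or lx ll'n xl' !ni //; [right|left|left].
- move=> h hE; rewrite iE // (mem_leaf ll) // (mem_leaf ll') // (mem_deg2 d2 fx hE).
  by rewrite -/g -gl'; case: (h == edge_of l); case: (h == g).
by have := iE h hE; rewrite hs !inE eqxx !orbT.
Qed.

(** If the leaf edges differ, the resulting hyperedge contains leaves of both. If they agree,
    distinct leaves or distinct degree-2 vertices would be twins, which [covers] confines to [F]. *)
Lemma other_edge_inj (F : {set 'I_n}) (l x l' x' : 'I_n) : covers F ->
  l \in leaves -> l' \in leaves -> l \notin F -> x \notin F ->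
  x \in edge_of l -> x' \in edge_of l' -> #|inc x| = 2 -> #|inc x'| = 2 ->
  other_edge (edge_of l) x = other_edge (edge_of l') x' -> l = l' /\ x = x'.
Proof.
move=> [H1 H2] ll ll' lF xF xl xl' d2 d2' eg.
have [fE lf] := edge_of_leaf ll; have [fE' lf'] := edge_of_leaf ll'.
have fx : edge_of l \in inc x by rewrite mem_inc fE.
have fx' : edge_of l' \in inc x' by rewrite mem_inc fE'.
have [incx ne] := inc_deg2 d2 fx; have [incx' ne'] := inc_deg2 d2' fx'.
move: incx' ne'; rewrite -eg => incx' ne'.
case: (eqVneq (edge_of l) (edge_of l')) => ef.
  split; apply/eqP; first by apply: contraNT lF => /H1; apply.
  apply: contraNT xF => xx'; apply: (H2 x x' l) => //.
  by rewrite incx incx' ef.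
have lx y z : y \in leaves -> #|inc z| = 2 -> y != z.
  by move=> ly dz; apply: contraTneq ly => ->; rewrite inE dz.
have [||h hE hs] := @free4_edge l x x' l'.
- have xx' : x != x'.
    apply: contraNneq ef => e; move: fx'; rewrite -e incx !inE eq_sym.
    by rewrite [edge_of l' == _]eq_sym (negPf ne') orbF.
  have ll'n : l != l' by apply: contraNneq ef => ->.
  rewrite /= !inE !negb_or ll'n xx' (lx l x) // (lx l x') //.
  by rewrite (eq_sym x l') (eq_sym x' l') (lx l' x) // (lx l' x').
- move=> h hE; rewrite (mem_leaf ll) // (mem_leaf ll') //.
  rewrite (mem_deg2 d2 fx hE) (mem_deg2 d2' fx' hE) -eg.
  by case: (h == edge_of l); case: (h == edge_of l');
    case: (h == other_edge (edge_of l) x).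
have lh : l \in h by rewrite hs mem_head.
have lh' : l' \in h by rewrite hs !inE eqxx !orbT.
move: lh lh'; rewrite (mem_leaf ll) // (mem_leaf ll') // => /eqP -> .
by rewrite (negPf ef).
Qed.

Definition leaf_pairs : {set 'I_n * 'I_n} :=
  [set p | (p.1 \in leaves) && (p.2 \in edge_of p.1 :\ p.1)].

Lemma card_leaf_pairs (A : {set 'I_n}) : A \subset leaves ->
  #|[set p : 'I_n * 'I_n | (p.1 \in A) && (p.2 \in edge_of p.1 :\ p.1)]| = 3 * #|A|.
Proof.
move=> /subsetP Al; rewrite (card_dep_pairs A (fun l => edge_of l :\ l)) mulnC -sum_nat_const.
apply: eq_bigr => l /Al /edge_of_leaf [/unif + lf].
by rewrite (cardsD1 l) lf add1n => -[].
Qed.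

(** Each leaf [l] has three pairs (l, x). Leaves in [F] account for 3 each, degree-2 vertices [x] in
    [F] for at most 2 each, and [x] of degree d >= 3 for at most d; the remaining pairs inject into
    the receivers. *)
Lemma leaf_bound (F : {set 'I_n}) : covers F ->
  3 * #|leaves| <= 3 * #|F| + \sum_(x | 2 < #|inc x|) #|inc x| + #|receivers F|.
Proof.
move=> cF; have [H1 H2] := cF.
rewrite -card_leaf_pairs // -/leaf_pairs.
pose deg2 := [set x | #|inc x| == 2].
pose B1 := [set p in leaf_pairs | p.1 \in F].
pose B2 := [set p in leaf_pairs | [&& p.1 \notin F, p.2 \in F & p.2 \in deg2]].
pose Q2 := [set p in leaf_pairs | [&& p.1 \notin F, p.2 \notin F & p.2 \in deg2]].
pose Q3 := [set p in leaf_pairs | (p.1 \notin F) && (2 < #|inc p.2|)].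
have pairP p : p \in leaf_pairs ->
    [/\ p.1 \in leaves, p.2 \in edge_of p.1, p.2 != p.1 & edge_of p.1 \in inc p.2].
  rewrite inE => /andP [ll]; rewrite in_setD1 => /andP [ne pl]; split=> //.
  by rewrite mem_inc pl andbT; case: (edge_of_leaf ll).
have cover : leaf_pairs \subset B1 :|: B2 :|: Q2 :|: Q3.
  apply/subsetP => p pp; rewrite !in_setU.
  rewrite [p \in B1]inE [p \in B2]inE [p \in Q2]inE [p \in Q3]inE pp /=.
  have [ll pl ne ip] := pairP p pp.
  case: (boolP (p.1 \in F)) => //= lF; rewrite ![_ \in deg2]inE.
  have : 0 < #|inc p.2| by apply/card_gt0P; exists (edge_of p.1).
  case d: #|inc p.2| => [|[|[|k]]] //= _; last by rewrite !orbT.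
    have l2 : p.2 \in leaves by rewrite inE d.
    case/negP: lF; apply: (H1 p.1 p.2) => //; first by rewrite eq_sym.
    by move: ip; rewrite inc_leaf // inE => /eqP.
  by case: (p.2 \in F).
apply: leq_trans (subset_leq_card cover) _.
have cB1 : #|B1| <= 3 * #|F :&: leaves|.
  rewrite -card_leaf_pairs ?subsetIr //; apply: subset_leq_card; apply/subsetP => p.
  by rewrite !inE => /andP [/andP [-> ->] ->].
have inj (A : {set 'I_n * 'I_n}) : A \subset leaf_pairs -> {in A, forall p, p.1 \notin F} ->
    {in A &, injective (fun p => (p.2, edge_of p.1))}.
  move=> /subsetP Al AF [l x] [l' x'] pA pA' [-> el]; congr (_, _).
  have [ll _ _ _] := pairP _ (Al _ pA); have [ll' _ _ _] := pairP _ (Al _ pA').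
  by apply/eqP; apply: contraNT (AF _ pA) => /(H1 _ _ ll ll'); apply.
have cB2 : #|B2| <= 2 * #|F :&: deg2|.
  rewrite mulnC -sum_nat_const.
  rewrite (eq_bigr (fun x => #|inc x|)); last by move=> x; rewrite !inE => /andP [_ /eqP].
  rewrite -card_dep_pairs; apply: card_le_in (inj B2 _ _) _.
  - by apply/subsetP => p; rewrite inE => /andP [].
  - by move=> p; rewrite inE => /and3P [].
  move=> p; rewrite inE => /and4P [pp _ pF p2]; have [_ _ _ ip] := pairP p pp.
  by rewrite inE /= inE pF p2.
have cQ3 : #|Q3| <= \sum_(x | 2 < #|inc x|) #|inc x|.
  rewrite (eq_bigl (mem [set x | 2 < #|inc x|])); last by move=> x; rewrite !inE.
  rewrite -card_dep_pairs; apply: card_le_in (inj Q3 _ _) _.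
  - by apply/subsetP => p; rewrite inE => /andP [].
  - by move=> p; rewrite inE => /and3P [].
  move=> p; rewrite inE => /and3P [pp _ p3]; have [_ _ _ ip] := pairP p pp.
  by rewrite inE /= inE p3.
have cQ2 : #|Q2| <= #|receivers F|.
  apply: (@card_le_in _ _ (fun p => other_edge (edge_of p.1) p.2)).
    move=> [l x] [l' x']; rewrite !inE /=.
    move=> /and4P [/andP [ll /andP [_ xl]] lF xF /eqP d2].
    move=> /and4P [/andP [ll' /andP [_ xl']] lF' xF' /eqP d2'].
    by case/(@other_edge_inj F) => //; rewrite ?inE // => -> ->.
  move=> p; rewrite inE => /and4P [pp _ xF]; have [ll pl _ _] := pairP p pp.
  by rewrite inE => /eqP; apply: other_edge_receiver.
have cF3 : #|F :&: leaves| + #|F :&: deg2| <= #|F|.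
  rewrite -cardsUI [X in _ + X](_ : _ = 0) ?addn0.
    by rewrite -setIUr subset_leq_card ?subsetIl.
  apply/eqP; rewrite cards_eq0; apply/eqP/setP => x; rewrite !inE.
  by case: #|inc x| => [|[|[|d]]]; rewrite ?andbF.
have := cardsUI (B1 :|: B2 :|: Q2) Q3; have := cardsUI (B1 :|: B2) Q2.
have := cardsUI B1 B2.
lia.
Qed.

(** Leaves outside [F] have distinct edges, none of which is a receiver once an isolated vertex
    exists. *)
Lemma receivers_bound (F : {set 'I_n}) : covers F -> isolated != set0 ->
  #|receivers F| + #|leaves| <= #|E| + #|F|.
Proof.
move=> [H1 _] iso.
have : #|leaves :\: F| <= #|E :\: receivers F|.
  apply: (@card_le_in _ _ edge_of).
    move=> l l'; rewrite !inE => /andP [lF ll] /andP [lF' ll'] el.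
    by apply/eqP; apply: contraNT lF => ne; apply: H1 ne el; rewrite inE.
  move=> l /setDP [ll lF]; have [fE lf] := edge_of_leaf ll.
  rewrite !inE fE /= (negPf iso) negb_and /= andbT; apply/orP; right.
  by apply/pred0Pn; exists l; rewrite /= ll.
have := cardsID F leaves; have := cardsID (receivers F) E.
rewrite (setIidPr _); last by apply/subsetP => g; rewrite inE => /andP [].
have : #|leaves :&: F| <= #|F| by rewrite subset_leq_card ?subsetIr.
lia.
Qed.

Lemma isolated_bound : #|isolated| <= 3.
Proof.
rewrite leqNgt; apply/negP => /card_geqP [s [us s4 si]].
have i0 x : x \in s -> inc x = set0.
  by move=> /si; rewrite inE cards_eq0 => /eqP.
case: s us s4 si i0 => [|a [|b [|c [|d [|? ?]]]]] // us _ _ i0.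
have [||h hE hs] := twin_pairs_edge us.
- by rewrite !i0 // !inE eqxx ?orbT.
- by rewrite !i0 // !inE eqxx ?orbT.
have : h \in inc a by rewrite mem_inc hE hs mem_head.
by rewrite i0 ?mem_head // in_set0.
Qed.

(** Two isolated vertices are twins too, and with [x], [x'] they would form a hyperedge. *)
Lemma twin_isolated_bound (x x' : 'I_n) :
  x != x' -> inc x = inc x' -> inc x != set0 -> #|isolated| <= 1.
Proof.
move=> xx' ix x0; rewrite leqNgt; apply/negP => /card_gt1P [i [j [ii jj ij]]].
have i0 y : y \in isolated -> inc y = set0.
  by rewrite inE cards_eq0 => /eqP.
have ni z y : inc z = inc x -> y \in isolated -> y != z.
  by move=> iz /i0 iy; apply: contraNneq x0 => yz; rewrite -iz -yz iy.
have [|||h hE hs] := @twin_pairs_edge i j x x'.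
- by rewrite /= !inE !negb_or ij xx' !ni.
- by rewrite !i0.
- by [].
have : h \in inc i by rewrite mem_inc hE hs mem_head.
by rewrite i0 // in_set0.
Qed.

Lemma semisat_lower_bound : 100 <= n -> 6 * n - 11 <= 13 * #|E|.
Proof.
move=> n100; have [F cF FE] := covers_ex.
have dc := degree_count; have lb := leaf_bound cF; have i3 := isolated_bound.
(* A nonempty [F] costs 3 * 4 and, not being a receiver itself, saves 1: hence the constant 11. *)
have F4 : #|F| = 0 \/ [/\ #|F| = 4, #|isolated| <= 1 & #|receivers F| + 1 <= #|E|].
  case: FE => [->|[FE [x [x' [xx' ix x0]]]]]; first by left; rewrite cards0.
  right; split; first exact: unif.
    exact: twin_isolated_bound ix x0.
  rewrite addn1; apply: proper_card; apply/properP; split.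
    by apply/subsetP => g; rewrite inE => /andP [].
  by exists F; rewrite // !inE eqxx andbF.
have rE : #|receivers F| <= #|E|.
  by apply: subset_leq_card; apply/subsetP => g; rewrite inE => /andP [].
case: (eqVneq isolated set0) => [i0|iso].
  move: dc; rewrite i0 cards0; case: F4 => [|[]]; lia.
(* Now 6n <= 13 #E + 22 - #leaves, which suffices for at least 11 leaves; with fewer, [degree_count]
   and n >= 100 do. *)
have := receivers_bound cF iso.
case: F4 => [|[]]; lia.
Qed.

End LowerBound.

(** * Sharpness *)

Definition free (T : eqType) (hs : seq (seq T)) (s : seq T) : bool :=
  all (fun f => count (mem f) s != 1) hs.

Definition grid (k m : nat) : seq (nat * nat) :=
  [seq (i, j) | i <- iota 0 k, j <- iota 0 m].

Lemma mem_grid (k m : nat) (x : nat * nat) :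
  (x \in grid k m) = (x.1 < k) && (x.2 < m).
Proof.
apply/allpairsP/andP => [[[i j] [/= ik jm ->]] | [xk xm]].
  by rewrite !mem_iota in ik jm *.
by exists x; rewrite !mem_iota; case: x xk xm.
Qed.

(** Excluding sizes 1 and 2 as well makes the property stable under disjoint union, since 4 = 1 + 3
    = 2 + 2. Size 3 cannot be excluded: in [block k], the elements (i, 0), (i, 1), (i, 2) form a
    free list. *)
Record spread (k : nat) (hs : seq (seq (nat * nat))) : Prop := Spread {
  spread_size : size hs = 6 * k;
  spread_edge : forall f, f \in hs ->
    [/\ uniq f, size f = 4 & {subset f <= grid k 13}];
  spread_free : forall s, uniq s -> {subset s <= grid k 13} -> free hs s ->
    size s \notin [:: 1; 2; 4] }.

(** The vertex [(i, j)] of the hypergraph is the [j]-th edge or half-edge of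
    gadget [i] of the graph, and [ends] lists its end nodes. *)
Definition ends (k : nat) (x : nat * nat) : seq (nat * nat) :=
  let (i, j) := x in
  let r s := (i + s) %% k in
  nth [::]
    [:: [:: (i, 0)]; [:: (i, 1)]; [:: (i, 0); (i, 1)];
        [:: (i, 0); (i, 2)]; [:: (i, 0); (i, 3)];
        [:: (i, 1); (i, 4)]; [:: (i, 1); (i, 5)];
        [:: (i, 4); (r 1, 5)]; [:: (i, 4); (r 3, 3)]; [:: (i, 4); (r 2, 5)];
        [:: (i, 2); (r 3, 5)]; [:: (i, 2); (r 3, 3)]; [:: (i, 2); (r 2, 3)]] j.

(** The hyperedge at a node, dual to [ends]; adding [k] first keeps the subtraction from truncating
    when k >= 3. *)
Definition star (k : nat) (p : nat * nat) : seq (nat * nat) :=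
  let (i, t) := p in
  let l s := (i + k - s) %% k in
  nth [::]
    [:: [:: (i, 0); (i, 2); (i, 3); (i, 4)];
        [:: (i, 1); (i, 2); (i, 5); (i, 6)];
        [:: (i, 3); (i, 10); (i, 11); (i, 12)];
        [:: (i, 4); (l 3, 8); (l 3, 11); (l 2, 12)];
        [:: (i, 5); (i, 7); (i, 8); (i, 9)];
        [:: (i, 6); (l 1, 7); (l 2, 9); (l 3, 10)]] t.

Definition block (k : nat) := [seq star k p | p <- grid k 6].

(** A free superset of [s] contains a further element at each lonely node of [s],
    so [no_free_ext k r s] need only branch over [star k p] for one such [p]. *)
Definition lonely (k : nat) (s : seq (nat * nat)) : seq (nat * nat) :=
  [seq p <- flatten [seq ends k x | x <- s]
     | count (fun x => p \in ends k x) s == 1].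

Fixpoint no_free_ext (k r : nat) (s : seq (nat * nat)) : bool :=
  if r is r'.+1 then
    all (fun y => if y \in s then true else no_free_ext k r' (y :: s))
      (if lonely k s is p :: _ then star k p else grid k 13)
  else lonely k s != [::].

Definition ends_star_dual (k : nat) : bool :=
  all (fun x => all (mem (grid k 6)) (ends k x) &&
    all (fun p => (p \in ends k x) == (x \in star k p)) (grid k 6))
    (grid k 13).

Definition star_wf (k : nat) : bool :=
  all (fun p => [&& uniq (star k p), size (star k p) == 4
                  & all (mem (grid k 13)) (star k p)]) (grid k 6).

(** Adding 0, 1 or 3 elements to a single one gives the sizes 1, 2 and 4. *)
Definition no_small_free (k : nat) : bool :=
  all (fun r => all (fun x => no_free_ext k r [:: x]) (grid k 13)) [:: 0; 1; 3].

Lemma block_ends_star_dual : all ends_star_dual (iota 4 4).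
Proof. by vm_compute. Qed.

Lemma block_star_wf : all star_wf (iota 4 4).
Proof. by vm_compute. Qed.

Lemma block_no_small_free : all no_small_free (iota 4 4).
Proof. by vm_compute. Qed.

(** * Soundness of the search *)

Lemma count_sub_ex (T : eqType) (a : pred T) (s s' : seq T) :
  uniq s -> uniq s' -> {subset s <= s'} -> count a s != count a s' ->
  exists y, [/\ y \in s', y \notin s & a y].
Proof.
move=> us us' ss' neq.
case: (boolP (has (fun y => (y \notin s) && a y) s')) => [/hasP [y ys' /andP [ys ay]]|].
  by exists y.
move=> /hasPn no; case/eqP: neq; rewrite -!size_filter; apply: perm_size.
apply: uniq_perm; rewrite ?filter_uniq // => x; rewrite !mem_filter.
case ax: (a x) => //=; apply/idP/idP => [/ss' //| xs'].
by move: (no x xs'); rewrite ax andbT negbK.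
Qed.

Lemma no_free_extP (k r : nat) (s s' : seq (nat * nat)) :
  ends_star_dual k -> uniq s -> uniq s' -> {subset s <= s'} ->
  {subset s' <= grid k 13} -> free (block k) s' -> size s' = size s + r ->
  ~~ no_free_ext k r s.
Proof.
move=> /allP dual us us' + sg fr; move: us.
have memE p x : p \in grid k 6 -> x \in grid k 13 ->
    (p \in ends k x) = (x \in star k p).
  by move=> pg xg; case/andP: (dual x xg) => _ /allP /(_ p pg) /eqP.
have lonelyP (t : seq (nat * nat)) p : p \in lonely k t -> {subset t <= s'} ->
    [/\ p \in grid k 6, count (fun x => p \in ends k x) t = 1
      & count (fun x => p \in ends k x) s' != 1].
  rewrite mem_filter => /andP [/eqP c1 /flatten_mapP [x xt px]] ts.
  have pg : p \in grid k 6.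
    by case/andP: (dual x (sg _ (ts _ xt))) => /allP /(_ p px).
  split=> //; move/allP: fr => /(_ (star k p) (map_f _ pg)).
  rewrite (@eq_in_count _ (mem (star k p)) (fun x => p \in ends k x)) //.
  by move=> y ys /=; rewrite memE ?sg.
elim: r s => [|r IH] s us ss' sz /=.
  rewrite negbK; case El: (lonely k s) => [//|p l].
  have pl : p \in lonely k s by rewrite El mem_head.
  have [pg c1 /eqP[]] := lonelyP s p pl ss'.
  have [_ eqs] : (size s = size s') * (s =i s').
    by apply: uniq_min_size => //; rewrite sz addn0.
  by rewrite -(permP (uniq_perm us us' eqs)) c1.
(* Some branch of the search stays inside [s']. *)
suff [y [ys' ys yl]] : exists y, [/\ y \in s', y \notin s &
    y \in (if lonely k s is p :: _ then star k p else grid k 13)].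
  apply/allPn; exists y => //; rewrite (negPf ys) IH //=.
  - by rewrite ys.
  - by move=> x /[!inE] /predU1P [-> //|/ss'].
  - by rewrite sz addnS addSn.
case El: (lonely k s) => [|p l].
  have [||||y [ys' ys _]] := @count_sub_ex _ xpredT s s' => //.
    by rewrite !count_predT sz -{1}[size s]addn0 eqn_add2l.
  by exists y; rewrite sg.
have pl : p \in lonely k s by rewrite El mem_head.
have [pg c1 c2] := lonelyP s p pl ss'.
have [||||y [ys' ys py]] := @count_sub_ex _ (fun x => p \in ends k x) s s' => //.
  by rewrite c1 eq_sym.
by exists y; rewrite -memE ?sg.
Qed.

Lemma spread_block (k : nat) : 4 <= k < 8 -> spread k (block k).
Proof.
move=> k48; have ki : k \in iota 4 4 by rewrite mem_iota.
have dual := allP block_ends_star_dual k ki.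
have wf := allP block_star_wf k ki.
have small := allP block_no_small_free k ki.
split.
- by rewrite size_map size_allpairs !size_iota mulnC.
- move=> f /mapP [p pg ->]; case/and3P: (allP wf p pg) => u /eqP sz /allP sub.
  by [].
move=> s us sg fr; apply/negP => sz.
have [x xs] : exists x, x \in s.
  by case: s sz {us sg fr} => // x s _; exists x; rewrite mem_head.
have r013 : (size s).-1 \in [:: 0; 1; 3] by move: sz; rewrite !inE; lia.
have := allP (allP small _ r013) x (sg x xs).
apply/negP; apply: (@no_free_extP k _ [:: x] s) => //=.
  by move=> y /[!inE] /eqP ->.
by rewrite add1n prednK //; case: (s) xs.
Qed.

(** * Disjoint unions *)

Definition shift (d : nat) (x : nat * nat) : nat * nat := (x.1 + d, x.2).

Lemma shift_inj (d : nat) : injective (shift d).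
Proof. by move=> [a b] [c e] [] /addIn -> ->. Qed.

(** No hyperedge meets both parts, so a free list splits into two free lists. *)
Lemma spread_cat (k1 k2 : nat) (h1 h2 : seq (seq (nat * nat))) :
  spread k1 h1 -> spread k2 h2 ->
  spread (k1 + k2) (h1 ++ [seq map (shift k1) f | f <- h2]).
Proof.
move=> [z1 e1 f1] [z2 e2 f2]; split.
- by rewrite size_cat size_map z1 z2 mulnDr.
- move=> f; rewrite mem_cat => /orP [/e1 [u z sub]|/mapP [g /e2 [u z sub] ->]].
    split=> // x /sub; rewrite !mem_grid; lia.
  split; rewrite ?size_map ?(map_inj_uniq (@shift_inj k1)) // => x.
  by move=> /mapP [y /sub + ->]; rewrite !mem_grid /=; lia.
move=> s us sg; rewrite /free all_cat => /andP [fr1 fr2].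
pose s1 := [seq x <- s | x.1 < k1].
pose s2 := [seq (x.1 - k1, x.2) | x <- s & k1 <= x.1].
have sz : size s = size s1 + size s2.
  rewrite size_map !size_filter -(count_predC (fun x : nat * nat => x.1 < k1) s).
  by congr (_ + _); apply: eq_count => x /=; rewrite -leqNgt.
have n1 : size s1 \notin [:: 1; 2; 4].
  apply: f1; first exact: filter_uniq.
    by move=> x; rewrite mem_filter => /andP [lt /sg]; rewrite !mem_grid lt => /andP [].
  apply/allP => f fh; move/allP: fr1 => /(_ f fh).
  rewrite count_filter (eq_in_count (a2 := predI (mem f) (fun x => x.1 < k1))) //.
  move=> x _ /=; case xf: (x \in f) => //=; case: (e1 f fh) => _ _ /(_ x xf).
  by rewrite mem_grid => /andP [->].
have n2 : size s2 \notin [:: 1; 2; 4].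
  apply: f2.
  - rewrite map_inj_in_uniq ?filter_uniq // => [[a b] [c d]].
    by rewrite !mem_filter /= => /andP [ka _] /andP [kc _] [e ->]; congr (_, _); lia.
  - move=> x /mapP [y]; rewrite mem_filter => /andP [ky /sg] + ->.
    by rewrite !mem_grid /= ltn_subLR.
  apply/allP => f fh; move/allP: fr2 => /(_ _ (map_f _ fh)).
  rewrite count_map count_filter (eq_in_count
    (a2 := predI (preim (fun x => (x.1 - k1, x.2)) (mem f)) (fun x => k1 <= x.1))) //.
  move=> [a b] _ /=; case: leqP => ka /=; last first.
    by rewrite andbF; apply/mapP => -[[c d] _ [ac _]]; lia.
  rewrite andbT -[RHS](mem_map (@shift_inj k1)) /shift /=.
  by rewrite subnK.
move: n1 n2; rewrite sz !inE; lia.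
Qed.

(** Blocks of 4 gadgets are split off until 4 to 7 gadgets remain. *)
Lemma spread_ex (k : nat) : 4 <= k -> exists hs, spread k hs.
Proof.
elim/ltn_ind: k => k IH k4; case: (ltnP k 8) => k8.
  by exists (block k); apply: spread_block; rewrite k4.
have [||h sp] := IH (k - 4); try lia.
exists (block 4 ++ [seq map (shift 4) f | f <- h]).
by rewrite -(subnKC k4); apply: spread_cat => //; apply: spread_block.
Qed.

(** Distinctness of the [6 * k + 1] listed hyperedges is not needed: the lower
    bound on [#|E|] rules out repetitions. *)
Lemma semisat_construction (k n : nat) : 4 <= k -> n = 13 * k + 4 ->
  exists E : {set {set 'I_n}},
    [/\ uniform4 E, B4_semisat E & #|E| <= 6 * k + 1].
Proof.
move=> /spread_ex [hs [sz edge fr]] nE.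
pose c (x : 'I_n) := (x %/ 13, x %% 13).
have c_inj : injective c.
  by move=> x y [q r]; apply: val_inj; rewrite /= (divn_eq x 13) q r -divn_eq.
(* The last four of the 13k + 4 vertices have quotient [k] and form the single disjoint
   hyperedge. *)
pose K := [seq (k, j) | j <- iota 0 4].
pose V := codom c.
have VE x : (x \in V) = (x \in grid k 13) || (x \in K).
  apply/codomP/orP => [[i ->]|xk].
    have := ltn_ord i; rewrite mem_grid /c /= => lt_in.
    case: (ltnP (i %/ 13) k) => ik; first by left; rewrite ltn_mod.
    right; apply/mapP; exists (i %% 13); last by congr (_, _); lia.
    by rewrite mem_iota; lia.
  have lt_xn : x.1 * 13 + x.2 < n.
    case: xk => [|/mapP [j] + ->]; rewrite ?mem_grid ?mem_iota /=; lia.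
  exists (Ordinal lt_xn); case: x xk lt_xn => a b xk lt_xn; rewrite /c /=.
  have b13 : b < 13.
    by case: xk => [|/mapP [j + [_ ->]]]; rewrite ?mem_grid ?mem_iota /=; lia.
  by congr (_, _); lia.
pose es := K :: hs.
have esP f : f \in es -> [/\ uniq f, size f = 4 & {subset f <= V}].
  rewrite inE => /predU1P [->|/edge [u z sub]].
    split=> //.
      by rewrite map_inj_uniq ?iota_uniq // => a b [].
    by move=> x xK; rewrite VE xK orbT.
  by split=> // x /sub; rewrite VE => ->.
pose E := [set:: [seq [set x | c x \in f] | f <- es]].
have cardIE (e : {set 'I_n}) (f : seq (nat * nat)) :
    #|e :&: [set x | c x \in f]| = count (mem f) (map c (enum e)).
  rewrite count_map cardE /enum_mem -size_filter -filter_predI; congr size.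
  by apply: eq_filter => x; rewrite !inE andbC.
exists E; split.
- move=> g; rewrite inE => /mapP [f /esP [u z sub] ->].
  rewrite cardE -(size_map c) -z; apply/perm_size/uniq_perm => //.
    by rewrite map_inj_uniq ?enum_uniq.
  move=> x; apply/mapP/idP => [[y + ->]|xf]; first by rewrite mem_enum inE.
  have /codomP [y xy] := sub x xf.
  by exists y; rewrite // mem_enum inE -xy.
- move=> e e4 eE.
  pose s := map c (enum e).
  have us : uniq s by rewrite map_inj_uniq ?enum_uniq.
  have sV : {subset s <= V} by move=> x /mapP [y _ ->]; apply: codom_f.
  have s4 : size s = 4 by rewrite size_map -cardE e4.
  case: (boolP (free es s)) => [/= /andP [frK frhs]|/allPn [f fes]]; last first.
    rewrite negbK -cardIE => /eqP e1; exists [set x | c x \in f] => //.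
    by rewrite inE map_f.
  pose s1 := [seq x <- s | x \in grid k 13].
  have n1 : size s1 \notin [:: 1; 2; 4].
    apply: fr; first exact: filter_uniq.
      by move=> x; rewrite mem_filter => /andP [].
    apply/allP => f fh; move/allP: frhs => /(_ f fh).
    rewrite count_filter (eq_in_count (a2 := predI (mem f) (mem (grid k 13)))) //.
    by move=> x _ /=; case xf: (x \in f) => //=; case: (edge f fh) => _ _ /(_ x xf) ->.
  have sK : size s = size s1 + count (mem K) s.
    rewrite size_filter -(count_predC (mem (grid k 13)) s); congr (_ + _).
    apply: eq_in_count => x /sV; rewrite VE /=; case: (boolP (x \in grid k 13)) => //=.
    rewrite mem_grid => lt _; symmetry; apply/negbTE/mapP => -[j _ xk].
    by move: lt; rewrite xk /= ltnn.
  (* Of the splits of 4 between the grid and [K], freeness against [K] excludes 3 + 1, and [n1]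
     excludes 4 + 0, 2 + 2 and 1 + 3. *)
  have cK : count (mem K) s = size s.
    move: sK frK n1; rewrite s4 !inE /=.
    by move: (count _ _) (size s1) => p q; lia.
  have {cK} /allP sK4 : all (mem K) s by rewrite all_count cK.
  have [_ sKE] := uniq_min_size us sK4 (eq_leq (esym s4)).
  case/negP: eE; rewrite inE; apply/mapP; exists K; rewrite ?mem_head //.
  by apply/setP => x; rewrite inE -sKE mem_map // mem_enum.
- rewrite cardsE; apply: leq_trans (card_size _) _.
  by rewrite size_map /= sz addn1.
Qed.

(* wsat_4(n,B_4) = min #|E| over 4-uniform B_4-semi-saturated E on n vertices.
   Part 1: every such E has #|E| >= (6n-11)/13, i.e. 13 #|E| >= 6n - 11.
   Part 2: for n = 4 mod 13 the minimum equals (6n-11)/13, i.e. (given part 1)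
   some such E has 13 #|E| = 6n - 11. *)
Theorem theorem2p2 :
  (forall (n : nat) (E : {set {set 'I_n}}),
     100 <= n -> uniform4 E -> B4_semisat E -> 6 * n - 11 <= 13 * #|E|) /\
  (forall n : nat, 100 <= n -> n %% 13 = 4 ->
     exists E : {set {set 'I_n}},
       [/\ uniform4 E, B4_semisat E & 13 * #|E| = 6 * n - 11]).
Proof.
split=> [n E n100 unif sat|n n100 n4]; first exact: semisat_lower_bound.
have nE : n = 13 * (n %/ 13) + 4 by rewrite {1}(divn_eq n 13) n4 mulnC.
have [|E [unif sat cE]] := @semisat_construction (n %/ 13) n _ nE; first by lia.
exists E; split=> //; apply/eqP; rewrite eqn_leq semisat_lower_bound // andbT.
(* With k = n %/ 13, 13 * (6k + 1) = 6 * (13k + 4) - 11. *)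
lia.
Qed.
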